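(* Let $N_1,\dots,N_n\ge 0$ be integers with $N=\sum_{i=1}^n N_i$, and write the components of vectors $u\in\mathbb{R}^N$ as $u=(u_1,\dots,u_N)=(u_{11},\dots,u_{1N_1},u_{21},\dots,u_{2N_2},\dots,u_{n1},\dots,u_{nN_n})$. Fix $\bar x\in\mathbb{R}^n$. For each $1\le i\le n$ and $1\le h\le N_i$ let $\varphi_{ih}$ be a real-valued function of $n-1$ real variables defined on a neighborhood of $\bar x'^{\,i}$, let $\bar\varphi\in\mathbb{R}^N$ be the point with components $\bar\varphi_{ih}:=\varphi_{ih}(\bar x'^{\,i})$, and let $f_{ih}$ be a real-valued function of $(x,u)\in\mathbb{R}^n\times\mathbb{R}^N$ defined on a neighborhood of $(\bar x,\bar\varphi)$. Assume there exist numbers $a,b,L>0$ such that the functions $f_{ih}$ and $\varphi_{ih}$ ($1\le i\le n$, $1\le h\le N_i$) satisfy: (A1) Each $f_{ih}$ maps $B_{a,b}:=B_a(\bar x)\times B_b(\bar\varphi)$ continuously into $\mathbb{R}$, with $$|f_{ih}(x,u)-f_{ih}(x,v)|\le L|u-v|\qquad\text{for }(x,u),(x,v)\in B_{a,b}.$$ (A2) Each $\varphi_{ih}$ maps $B_a(\bar x'^{\,i})$ continuously into $\mathbb{R}$, with $$|\varphi_{ih}(x'^{\,i})-\bar\varphi_{ih}|\le \frac{b}{2N}\qquad\text{for }x'^{\,i}\in B_a(\bar x'^{\,i}).$$ Then, with $$M:=\max_{i,h}\,\sup\{|f_{ih}(x,u)| : (x,u)\in B_{a,b}\}\qquad\text{and}\qquad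 \sigma:=\min\Big(a,\frac{b}{2MN}\Big),$$ the PDE system $$\frac{\partial u_{ih}}{\partial x_i}=f_{ih}(x_1,\dots,x_n,u_1,\dots,u_N)\qquad(1\le i\le n,\ 1\le h\le N_i),$$ with data $$u_{ih}(x'^{\,i}_{\bar x_i})=\varphi_{ih}(x'^{\,i})\qquad(1\le i\le n,\ 1\le h\le N_i),$$ has a unique solution $u(x)$ defined on $B_\sigma(\bar x)$. Here a solution means a classical, $C^1$ solution, i.e. a $C^1$ function $u$ that satisfies the PDEs and the data requirements in a pointwise manner.
   Context: Notation. For $x\in\mathbb{R}^n$, $\xi\in\mathbb{R}$ and $1\le i\le n$, $$x'^{\,i}:=(x_1,\dots,x_{i-1},x_{i+1},\dots,x_n)\in\mathbb{R}^{n-1},\qquad x'^{\,i}_\xi:=(x_1,\dots,x_{i-1},\xi,x_{i+1},\dots,x_n)\in\mathbb{R}^n.$$ Thus the data prescribe $u_{ih}$ along the hyperplane $\{x_i=\bar x_i\}$ through $\bar x$. Every Euclidean space $\mathbb{R}^k$ carries the 1-norm $|y|:=\sum_{j=1}^k|y_j|$, and $B_r(y):=\{z\in\mathbb{R}^k : |z-y|\le r\}$ is the corresponding closed ball. For each $i$, $u_{i1},\dots,u_{iN_i}$ are the unknowns that appear differentiated with respect to $x_i$; each scalar unknown appears differentiated exactly once in the system. If $N_i=0$, no equation involves differentiation with respect to $x_i$, there are no functions $f_{ih},\varphi_{ih}$ with first index $i$, and $x_i$ plays the role of a parameter. If $n=1$, the data $\varphi_{ih}$ are constants.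
   Formalization: ''C^1 solution'' is weakened to: each u_ih and its derivative in x_i are continuous on the ball; full C^1 fails for merely continuous data, e.g. n=2, N_1=1, N_2=0, f=0, φ=|x_2−x̄_2|. *)

(* Defs.v *)
(* MathComp / MathComp-Analysis *)
From HB Require Import structures.
From mathcomp Require Export all_boot all_order all_algebra.
From mathcomp Require Export all_classical all_reals all_analysis.

Set Implicit Arguments.
Unset Strict Implicit.
Unset Printing Implicit Defensive.

Import Order.TTheory GRing.Theory Num.Theory.
Import numFieldNormedType.Exports.

Local Open Scope classical_set_scope.
Local Open Scope ring_scope.

Section Darboux.
Context {R : realType}.

(* The library norm on ['rV[R]_k] is the sup norm; the bounds below depend on
   the 1-norm. *)
Definition norm1 k (y : 'rV[R]_k) : R := \sum_(j < k) `|y ord0 j|.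

Definition cball1 k (y : 'rV[R]_k) (r : R) : set 'rV[R]_k :=
  [set z | norm1 (z - y) <= r].

(* The point written x'^i_t; the point x'^i of R^(n-1) is [col' i x]. *)
Definition subst_coord n (x : 'rV[R]_n) (i : 'I_n) (t : R) : 'rV[R]_n :=
  \row_j (if j == i then t else x ord0 j).

(* [has_pderiv_on A g i x l]: the partial derivative of [g] with respect to x_i
   at [x] is [l], the difference quotient being taken along the points of [A].
   At an interior point of [A] this is the usual partial derivative; at an
   endpoint of the segment of [A] parallel to the i-th axis it is one-sided.
   When that segment is reduced to {x} (for a 1-norm ball of radius s around c:
   x_i = c_i and |x'^i - c'^i| = s) there is no difference quotient and the
   condition is void. *)
Definition has_pderiv_on n (A : set 'rV[R]_n) (g : 'rV[R]_n -> R) (i : 'I_n)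
    (x : 'rV[R]_n) (l : R) : Prop :=
  (g (subst_coord x i t) - g x) / (t - x ord0 i)
    @[t --> within [set t | A (subst_coord x i t)] ((x ord0 i)^')] --> l.

(* [g] is continuous on [A] and has on [A] a continuous partial derivative with
   respect to x_i. *)
Definition C1_in_coord n (A : set 'rV[R]_n) (i : 'I_n) (g : 'rV[R]_n -> R) :
    Prop :=
  {within A, continuous g} /\
  exists dg : 'rV[R]_n -> R,
    {within A, continuous dg} /\
    forall x, A x -> has_pderiv_on A g i x (dg x).

Section System.
Variables (n : nat) (N_ : 'I_n -> nat).

(* [tagnat.Rank i h] is the position of (i, h) in the lexicographic list
   (1,1), ..., (1,N_1), (2,1), ..., (n,N_n). *)
Definition comp (u : 'rV[R]_(\sum_i N_ i)) (i : 'I_n) (h : 'I_(N_ i)) : R :=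
  u ord0 (tagnat.Rank i h).

Variables (xbar : 'rV[R]_n)
  (phi : forall i : 'I_n, 'I_(N_ i) -> 'rV[R]_n.-1 -> R)
  (f : forall i : 'I_n, 'I_(N_ i) -> 'rV[R]_n * 'rV[R]_(\sum_i N_ i) -> R).

Definition phibar : 'rV[R]_(\sum_i N_ i) :=
  \mxrow_i \row_h phi h (col' i xbar).

Definition Bab (a b : R) : set ('rV[R]_n * 'rV[R]_(\sum_i N_ i)) :=
  cball1 xbar a `*` cball1 phibar b.

(* Under the continuity assumption on [f] each [sup] is that of a nonempty
   bounded set of nonnegative reals, so starting the maxima from 0 is harmless;
   it gives 0 when there are no equations. *)
Definition maxf (a b : R) : R :=
  \big[Num.max/0]_(i < n) \big[Num.max/0]_(h < N_ i)
    sup [set `|f h p| | p in Bab a b].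

(* b/(2MN) is +oo when M N = 0, whereas division by 0 in [R] gives 0. *)
Definition sigma (a b : R) : R :=
  let MN := maxf a b * (\sum_i N_ i)%:R in
  if MN == 0 then a else Num.min a (b / (2 * MN)).

(* Only the value of [f i h] on its domain of definition [Df i h] is meaningful,
   so a solution must have its graph there.
   "C^1" is understood equation by equation: the unknown u_ih and the only
   derivative of it that the system prescribes, the one with respect to x_i, are
   continuous. Continuous differentiability in the other variables cannot be
   asked for when the data are merely continuous: for n = 2, N_1 = 1, N_2 = 0
   and f = 0 the solution is u(x) = phi(x_2). *)
Definition is_solution
    (Df : forall i : 'I_n, 'I_(N_ i) -> set ('rV[R]_n * 'rV[R]_(\sum_i N_ i)))
    (B : set 'rV[R]_n) (u : 'rV[R]_n -> 'rV[R]_(\sum_i N_ i)) : Prop :=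
  forall (i : 'I_n) (h : 'I_(N_ i)),
    [/\ C1_in_coord B i (fun x => comp (u x) h),
        forall x, B x -> Df i h (x, u x),
        forall x, B x ->
          has_pderiv_on B (fun y => comp (u y) h) i x (f h (x, u x))
      & forall x, B x ->
          comp (u (subst_coord x i (xbar ord0 i))) h = phi h (col' i x)].

End System.
End Darboux.

(* Main.v *)
Require Import Defs.
From mathcomp Require Import lra ring.
Import Order.TTheory GRing.Theory Num.Theory.
Import numFieldNormedType.Exports.
Set Implicit Arguments.
Unset Strict Implicit.
Unset Printing Implicit Defensive.
Local Open Scope classical_set_scope.
Local Open Scope ring_scope.

(** Integrating the equation for [u_ih] in the variable [x_i] from the data
    hyperplane turns the system into the fixed point equation
    [u_ih(x) = phi_ih(x'^i) + int_(xbar_i)^(x_i) f_ih(x'^i_s, u(x'^i_s)) ds]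
    for functions that are merely continuous in [x].  The right-hand side is a
    contraction for the norm [sup_x |u(x)|_1 exp(- lam |x - xbar|_1)] when [lam]
    is large.  Indeed the 1-norm splits over the coordinates: on the segment of
    integration that ends at [x], whatever its direction, the weight
    [exp(lam |y - xbar|_1)] is an exponential of the distance covered, and its
    integral is at most [1 / lam] times its value at [x]
    ([integrates_on_weighted]).

    The domains of [f] and [phi] are balls.  Composing both with radial
    retractions onto these balls gives data that are defined everywhere, with
    [f] still bounded by [M] and Lipschitz in [u] (with constant [2 L]); for
    these data successive approximations converge on the whole space
    ([picard_exists]) and solutions are unique on any set that is stable under
    sliding one coordinate towards that of [xbar] ([picard_unique]).

    It remains to compare the two systems on the ball of radius [sigma].  They
    agree as long as the values stay in the ball of radius [b] around [phibar],
    and a solution of either system does stay there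
    ([integrates_on_invariant_ball]): as long as this holds on the way to [x], the
    value at [x] is within [b / 2 + M N |x - xbar|_1] of [phibar], so that a point
    nearest to [xbar] among those where the distance [b] is reached, if any, lies
    on the boundary of the ball of radius [sigma].  This applies to the global
    solution, which therefore solves the given system, and to an arbitrary
    solution of the given system, which therefore solves the retracted one and
    coincides with the former.

    Primitives are obtained from the fundamental theorem of calculus for the
    Lebesgue integral; every estimate is then read off from the derivatives, by
    the mean value theorem ([norm_increment_le]). *)

(** * Increments and primitives of functions of one real variable *)

(** The primitive is the integral from [c], with its sign; the fundamental
    theorem of calculus only sees points to the right of a fixed lower bound,
    hence the comparison [FE] with integrals from a far lower bound [a]. *)
Lemma primitive_exists (R : realType) (g : R -> R) (c : R) : continuous g ->
  exists F : R -> R, F c = 0 /\ forall t : R, is_derive t 1 F (g t).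
Proof.
move=> cg.
pose mu := @lebesgue_measure R.
have intg (a b : itv_bound R) (a' b' : R) : [set` Interval a b] `<=` `[a', b'] ->
    mu.-integrable [set` Interval a b] (EFin \o g).
  move=> ab; have : mu.-integrable `[a', b'] (EFin \o g).
    apply: (@continuous_compact_integrable R g); first exact: segment_compact.
    exact: continuous_subspaceT.
  by apply: integrableS.
pose F t := if c <= t then \int[mu]_(s in `]c, t]) g s
            else - \int[mu]_(s in `]t, c]) g s.
have FE a t : a < c -> a < t ->
    F t = \int[mu]_(s in `[a, t]) g s - \int[mu]_(s in `[a, c]) g s.
  move=> ac at_; rewrite /F; case: ifPn => [ct|].
    rewrite Rintegral_itvB ?bnd_simp//; last exact: ltW.
    exact: (@intg _ _ a t).
  rewrite -ltNge => tc.
  rewrite -[RHS]opprB Rintegral_itvB ?bnd_simp//; try exact: ltW.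
  exact: (@intg _ _ a c).
exists F; split.
  by rewrite (FE (c - 1) c) ?subrr//; lra.
move=> t; pose a := Num.min c t - 1.
have [ac at_] : a < c /\ a < t.
  have : Num.min c t <= c by rewrite ge_min lexx.
  have : Num.min c t <= t by rewrite ge_min lexx orbT.
  by rewrite /a; move=> ? ?; split; lra.
have tu : t < t + 1 by rewrite ltrDl.
have [dI I'] :=
  continuous_FTC1_closed tu (intg _ _ a (t + 1) (fun _ => id)) at_ (cg t).
set I := (fun x => _) in dI I'.
have isI : is_derive t 1 I (g t).
  by apply: DeriveDef => //; rewrite -derive1E.
have isK : is_derive t 1 (I - cst (\int[mu]_(s in `[a, c]) g s)) (g t).
  by rewrite -[X in is_derive _ _ _ X]subr0; apply: is_deriveB.
apply: (near_eq_is_derive _ isK).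
near=> s.
by rewrite (FE a)//; near: s; exact: lt_nbhsr.
Unshelve. all: by end_near. Qed.

(** The mean value theorem applied to [H + G] and to [H - G]. *)
Lemma norm_increment_le (R : realType) (G H dG dH : R -> R) :
  (forall s : R, s \in `]0, 1[%R -> is_derive s 1 G (dG s)) ->
  (forall s : R, s \in `]0, 1[%R -> is_derive s 1 H (dH s)) ->
  {within `[0, 1], continuous G} -> {within `[0, 1], continuous H} ->
  (forall s : R, s \in `]0, 1[%R -> `|dG s| <= dH s) ->
  `|G 1 - G 0| <= H 1 - H 0.
Proof.
move=> DG DH cG cH le_d; rewrite ler_norml.
have [] := @MVT _ (H + G) (fun s => dH s + dG s) 0 1 ltr01.
- by move=> s s01; have := DG s s01; have := DH s s01 => ? ?; exact: is_deriveD.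
- by move=> s; apply: continuousD; [exact: cH|exact: cG].
move=> s /le_d; rewrite ler_norml => /andP[dG_ge _] eqD.
have [] := @MVT _ (H - G) (fun s => dH s - dG s) 0 1 ltr01.
- by move=> r r01; have := DG r r01; have := DH r r01 => ? ?; exact: is_deriveB.
- by move=> r; apply: continuousD; [exact: cH|apply: continuousN; exact: cG].
move=> r /le_d; rewrite ler_norml => /andP[_ dG_le].
move: eqD; rewrite -![(_ + _) _]/(_ + _) -![(- _) _]/(- _) => eqD eqB.
by apply/andP; split; lra.
Qed.

(** The segment from [c] to [t] is run through by [s] in [0, 1] so that both
    orders of [c] and [t] are treated at once.  When [t = c] nothing is asked of
    the derivative, since a degenerate segment in a domain need not carry any
    information on a partial derivative. *)
Lemma segment_increment_le (R : realType) (g d H dH : R -> R) (c t : R) :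
  (t != c -> forall s : R, s \in `]0, 1[%R ->
    is_derive (c + s * (t - c)) 1 g (d s)) ->
  {within `[0, 1], continuous (fun s => g (c + s * (t - c)))} ->
  (forall s : R, is_derive s 1 H (dH s)) ->
  (forall s : R, s \in `]0, 1[%R -> `|t - c| * `|d s| <= dH s) ->
  `|g t - g c| <= H 1 - H 0.
Proof.
move=> dg cg DH le_d.
have := @norm_increment_le _ (fun s => g (c + s * (t - c))) H
  (fun s => (t - c) * d s) dH.
rewrite mul1r mul0r addr0 (addrC c (t - c)) subrK; apply => //.
- move=> s s01; have [->|tc] := eqVneq t c.
    rewrite subrr mul0r.
    rewrite (_ : (fun _ => _) = cst (g c)); last first.
      by apply/funext => r /=; rewrite mulr0 addr0.
    exact: is_derive_cst.
  have dgs := dg tc s s01.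
  have -> : (fun s => g (c + s * (t - c))) = g \o (cst c + (id * cst (t - c))).
    by [].
  apply: is_derive_eq.
  by rewrite scaler0 !add0r mulrC; congr (_ * _); exact: mulr1.
- by apply: derivable_within_continuous => s _; apply: ex_derive.
- by move=> s s01; rewrite normrM; exact: le_d.
Qed.

Lemma segment_increment_le_cst (R : realType) (g d : R -> R) (c t M : R) :
  (t != c -> forall s : R, s \in `]0, 1[%R ->
    is_derive (c + s * (t - c)) 1 g (d s)) ->
  {within `[0, 1], continuous (fun s => g (c + s * (t - c)))} ->
  (forall s : R, s \in `]0, 1[%R -> `|d s| <= M) ->
  `|g t - g c| <= M * `|t - c|.
Proof.
move=> dg cg dM.
have de (s : R) : is_derive s 1 (fun s => s * (M * `|t - c|)) (M * `|t - c|).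
  have -> : (fun s => s * (M * `|t - c|)) = id * cst (M * `|t - c|) by [].
  apply: is_derive_eq.
  by rewrite scaler0 add0r; exact: mulr1.
have := segment_increment_le dg cg de; rewrite mul1r mul0r subr0; apply=> s s01.
by rewrite mulrC ler_wpM2r// dM.
Qed.

Lemma continuous_affine (R : realType) (g : R -> R) (c t : R) :
  continuous g -> continuous (fun s : R => g (c + s * (t - c))).
Proof.
move=> cg s; apply: (@cvg_comp _ _ _ (fun s : R => c + s * (t - c)) g _
  (nbhs (c + s * (t - c)))); last exact: cg.
exact: (cvgD (cvg_cst _) (cvgM cvg_id (cvg_cst _))).
Qed.

Lemma is_derive_continuous (R : realType) (g d : R -> R) :
  (forall t : R, is_derive t 1 g (d t)) -> continuous g.
Proof.
move=> dg t; apply/differentiable_continuous/derivable1_diffP.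
exact: (@ex_derive _ _ _ _ _ _ _ (dg t)).
Qed.

(** * The 1-norm, its balls and the radial retraction *)

Section Norm1.
Context {R : realType}.
Implicit Types n : nat.

Lemma norm1_ge0 n (y : 'rV[R]_n) : 0 <= norm1 y.
Proof. by apply: sumr_ge0 => j _. Qed.

Lemma coord_le_norm1 n (y : 'rV[R]_n) j : `|y ord0 j| <= norm1 y.
Proof. by rewrite /norm1 (bigD1 j)//= lerDl sumr_ge0. Qed.

Lemma norm1_le0 n (y : 'rV[R]_n) : norm1 y <= 0 -> y = 0.
Proof.
move=> y0; apply/rowP => j; rewrite mxE; apply/eqP.
by rewrite -normr_le0 (le_trans (coord_le_norm1 _ _) y0).
Qed.

Lemma ler_norm1D n (x y : 'rV[R]_n) : norm1 (x + y) <= norm1 x + norm1 y.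
Proof. by rewrite -big_split; apply: ler_sum => j _; rewrite mxE ler_normD. Qed.

Lemma norm1Z n k (y : 'rV[R]_n) : norm1 (k *: y) = `|k| * norm1 y.
Proof. by rewrite /norm1 mulr_sumr; apply: eq_bigr => j _; rewrite mxE normrM. Qed.

Lemma norm1N n (y : 'rV[R]_n) : norm1 (- y) = norm1 y.
Proof. by apply: eq_bigr => j _; rewrite mxE normrN. Qed.

Lemma norm1_0 n : norm1 (0 : 'rV[R]_n) = 0.
Proof. by apply: big1 => j _; rewrite mxE normr0. Qed.

Lemma norm1_le_card n (y : 'rV[R]_n) K :
  (forall j, `|y ord0 j| <= K) -> norm1 y <= n%:R * K.
Proof.
move=> yK; rewrite -[n in n%:R]card_ord -sum1_card natr_sum mulr_suml.
by apply: ler_sum => j _; rewrite mul1r.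
Qed.

Lemma cvg_row n (T : Type) (F : set_system T) {FF : Filter F}
    (g : T -> 'rV[R]_n) (y : 'rV[R]_n) :
  (forall j, g x ord0 j @[x --> F] --> y ord0 j) -> g @ F --> y.
Proof.
move=> gy A [P Py PA].
apply: (@filterS _ _ _ [set x | forall j, P ord0 j (g x ord0 j)]).
  by move=> x Pg; apply: PA => i j; rewrite ord1.
by apply: filter_forall => j; apply: gy.
Qed.

Lemma cvg_norm1 n (T : Type) (F : set_system T) {FF : Filter F}
    (g : T -> 'rV[R]_n) (y : 'rV[R]_n) :
  g @ F --> y -> norm1 (g x) @[x --> F] --> norm1 y.
Proof.
move=> gy; apply: cvg_big => //; first exact: add_continuous.
move=> j _; apply: cvg_norm.
exact: (cvg_comp _ _ gy (@coord_continuous _ _ _ _ _ y)).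
Qed.

Lemma norm1_sub_continuous n (c : 'rV[R]_n) :
  continuous (fun x : 'rV[R]_n => norm1 (x - c)).
Proof. by move=> x; exact: (cvg_norm1 (cvgB cvg_id (cvg_cst _))). Qed.

Lemma cball1_compact n (c : 'rV[R]_n) r : compact (cball1 c r).
Proof.
have box_compact := @rV_compact R n
  (fun j => `[c ord0 j - r, c ord0 j + r]%classic) (fun j => @segment_compact _ _ _).
apply: (subclosed_compact _ box_compact) => [|x xr j /=]; last first.
  rewrite in_itv/= -ler_distlC distrC.
  by apply: le_trans xr; rewrite (le_trans _ (coord_le_norm1 _ j))// !mxE.
rewrite /cball1 -[X in closed X]/((fun x => norm1 (x - c)) @^-1` [set t | t <= r]).
apply: closed_comp; last exact: closed_le.
by move=> x _; exact: norm1_sub_continuous.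
Qed.

(** Points outside of the ball are moved onto its boundary along rays from [c];
    the maximum makes this a single formula. *)
Definition retract n (c : 'rV[R]_n) (r : R) (x : 'rV[R]_n) : 'rV[R]_n :=
  c + (Num.max 1 (norm1 (x - c) / r))^-1 *: (x - c).

Lemma retract_id n (c : 'rV[R]_n) r x : 0 < r -> cball1 c r x ->
  retract c r x = x.
Proof.
move=> r0 xr; rewrite /retract max_l ?invr1 ?scale1r ?[c + _]addrC ?subrK//.
by rewrite ler_pdivrMr// mul1r.
Qed.

Lemma retract_cball1 n (c : 'rV[R]_n) r x : 0 < r -> cball1 c r (retract c r x).
Proof.
move=> r0; rewrite /cball1/= /retract addrAC subrr add0r norm1Z.
set m := Num.max _ _.
have m1 : 1 <= m by rewrite le_max lexx.
have m0 : 0 < m by exact: lt_le_trans m1.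
rewrite ger0_norm ?invr_ge0 ?(ltW m0)// mulrC ler_pdivrMr//.
by rewrite mulrC -ler_pdivrMr// le_max lexx orbT.
Qed.

(** The constant is not 1 as for a Euclidean projection. Centred at [c], the
    difference of the images is [p^-1 (x - y) + (p^-1 - q^-1) y] with [p, q] at
    least 1, and each term is bounded by [|x - y|]: for the second one because
    [|q - p| <= |x - y| / r] and [|y| <= r q]. *)
Lemma retract_lipschitz n (c : 'rV[R]_n) r x y : 0 < r ->
  norm1 (retract c r x - retract c r y) <= 2 * norm1 (x - y).
Proof.
move=> r0; rewrite /retract opprD addrACA subrr add0r.
have -> : x - y = (x - c) - (y - c) by rewrite opprB addrA subrK.
move: (x - c) (y - c) => {}x {}y.
set p := Num.max 1 (norm1 x / r); set q := Num.max 1 (norm1 y / r).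
have p1 : 1 <= p by rewrite le_max lexx.
have q1 : 1 <= q by rewrite le_max lexx.
have p0 : 0 < p by exact: lt_le_trans p1.
have q0 : 0 < q by exact: lt_le_trans q1.
have yq : norm1 y <= r * q by rewrite mulrC -ler_pdivrMr// le_max lexx orbT.
have nxy : `|norm1 x - norm1 y| <= norm1 (x - y).
  rewrite ler_norml lerBrDr lerBlDr; apply/andP; split.
    rewrite addrC lerBlDr addrC -(norm1N (x - y)) opprB.
    by rewrite -{1}(subrK x y) ler_norm1D.
  by rewrite -{1}(subrK y x) ler_norm1D.
have pq : `|q - p| <= norm1 (x - y) / r.
  have : `|norm1 y / r - norm1 x / r| <= norm1 (x - y) / r.
    rewrite -mulrBl normrM [`|r^-1|]ger0_norm ?invr_ge0 ?(ltW r0)//.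
    by rewrite ler_pM2r ?invr_gt0// distrC.
  rewrite /p /q; case: (leP 1 (norm1 y / r)); case: (leP 1 (norm1 x / r));
    rewrite !ler_norml => ? ? /andP[? ?]; apply/andP; split; lra.
have -> : p^-1 *: x - q^-1 *: y = p^-1 *: (x - y) + (p^-1 - q^-1) *: y.
  by rewrite scalerBr scalerBl addrA subrK.
apply: le_trans (ler_norm1D _ _) _; rewrite !norm1Z mulr_natl mulr2n; apply: lerD.
  by rewrite ger0_norm ?invr_ge0 ?(ltW p0)// ler_piMl ?norm1_ge0// invf_le1.
have -> : p^-1 - q^-1 = (q - p) / (p * q) by field; rewrite !gt_eqF.
rewrite normrM [`|(p * q)^-1|]ger0_norm ?invr_ge0 ?mulr_ge0 ?(ltW p0) ?(ltW q0)//.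
rewrite mulrAC ler_pdivrMr ?mulr_gt0//.
apply: le_trans (ler_pM (normr_ge0 _) (norm1_ge0 y) pq yq) _.
rewrite mulrA divfK ?gt_eqF//; apply: ler_wpM2l; first exact: norm1_ge0.
by rewrite ler_peMl// ltW.
Qed.
End Norm1.

(** * Partial derivatives and motions parallel to an axis *)

Section DifferenceQuotient.
Context {R : realType}.

(** The derivative as a limit of quotients at the moving point [s] rather than at
    an increment tending to 0: this is the form used for partial derivatives. *)
Lemma is_derive_quotientP (f : R -> R) (t l : R) :
  is_derive t 1 f l <-> (f s - f t) / (s - t) @[s --> t^'] --> l.
Proof.
have shift_dnbhs (a b : R) : h + a @[h --> b^'] --> (b + a)^'.
  move=> W; rewrite /= /dnbhs /within/= => bW.
  have : (h + a @[h --> b] --> b + a) by exact: (cvgD cvg_id (cvg_cst _)).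
  move=> /(_ _ bW); rewrite nbhs_simpl/=; apply: filterS => h hW hb; apply: hW.
  by rewrite (inj_eq (addIr a)).
pose q s := (f s - f t) / (s - t).
have qE : (fun h => h^-1 *: ((f \o shift t) (h *: (1 : R)) - f t)) =
    q \o (fun h => h + t).
  apply/funext => h; rewrite /q/= addrK [h%:A]mulr1 -[LHS]/(_ * _).
  by rewrite mulrC.
split => [[df <-]|ql].
  have : (fun h => h^-1 *: ((f \o shift t) (h *: (1 : R)) - f t)) @ 0^' -->
    'D_1 f t by exact: df.
  have qK : (q \o (fun h => h + t)) \o (fun h => h - t) = q.
    by apply/funext => s /=; rewrite subrK.
  rewrite qE -/q -[in X in _ -> X]qK => dq; apply: cvg_comp dq.
  by rewrite -(subrr t); exact: shift_dnbhs.
have : (q \o (fun h => h + t)) @ 0^' --> l.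
  by apply: cvg_comp ql; have := shift_dnbhs t 0; rewrite add0r.
rewrite -qE => dl; apply: DeriveDef; first by apply/cvg_ex; exists l.
exact/cvg_lim.
Qed.
End DifferenceQuotient.

Section Coordinates.
Context {R : realType} {n : nat}.
Implicit Types (x c : 'rV[R]_n) (i : 'I_n) (s t : R) (B : set 'rV[R]_n).

Lemma subst_coordE x i t : subst_coord x i t ord0 i = t.
Proof. by rewrite mxE eqxx. Qed.

Lemma subst_coord_id x i : subst_coord x i (x ord0 i) = x.
Proof. by apply/rowP => j; rewrite mxE; case: eqP => // ->. Qed.

Lemma subst_coord_twice x i s t :
  subst_coord (subst_coord x i s) i t = subst_coord x i t.
Proof. by apply/rowP => j; rewrite !mxE; case: eqP. Qed.

Lemma cvg_subst_coord (T : Type) (A : set_system T) {FA : Filter A}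
    (y : T -> 'rV[R]_n) (r : T -> R) x i t :
  y @ A --> x -> r @ A --> t ->
  subst_coord (y z) i (r z) @[z --> A] --> subst_coord x i t.
Proof.
move=> yx rt; apply: cvg_row => j; rewrite mxE.
under eq_cvg do rewrite mxE.
case: ifP => // _.
exact: (cvg_comp _ _ yx (@coord_continuous _ _ _ _ _ x)).
Qed.

(** The point reached at time [s] when the [i]-th coordinate of [x] is brought
    affinely from that of [c] (at time 0) to its own value (at time 1). *)
Definition slide c x i s : 'rV[R]_n :=
  subst_coord x i (c ord0 i + s * (x ord0 i - c ord0 i)).

(** The distance to [c] is affine in the time of the motion: the advantage of the
    1-norm, on which the weighted estimate below rests. *)
Lemma norm1_slide c x i s : 0 <= s ->
  norm1 (slide c x i s - c) =
    norm1 (x - c) - `|x ord0 i - c ord0 i| + s * `|x ord0 i - c ord0 i|.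
Proof.
move=> s0; rewrite /norm1 (bigD1 i)//= [in RHS](bigD1 i)//=.
rewrite !mxE eqxx [c ord0 i + _]addrC addrK normrM (ger0_norm s0).
rewrite [`|_| + _]addrC addrK addrC; congr (_ + _).
by apply: eq_bigr => j /negbTE ji; rewrite !mxE ji.
Qed.

Lemma slide_continuous c i :
  continuous (fun p : 'rV[R]_n * R => slide c p.1 i p.2).
Proof.
move=> [x s]; apply: cvg_subst_coord; first exact: cvg_fst.
have xi : (fun p : 'rV[R]_n * R => p.1 ord0 i) p @[p --> (x, s)] --> x ord0 i.
  apply: (@cvg_comp _ _ _ fst (fun y : 'rV[R]_n => y ord0 i) _ (nbhs x)).
    exact: cvg_fst.
  exact: coord_continuous.
exact: (cvgD (cvg_cst _) (cvgM cvg_snd (cvgB xi (cvg_cst _)))).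
Qed.

(** Stability under the motions that bring one coordinate to that of [c]: the
    integral form of the system, with data on the hyperplanes through [c], makes
    sense on such sets. *)
Definition slide_stable c B :=
  forall x i s, B x -> 0 <= s <= 1 -> B (slide c x i s).

Lemma cball1_slide_stable c r : slide_stable c (cball1 c r).
Proof.
move=> x i s xr /andP[s0 s1]; rewrite /cball1/= norm1_slide//.
apply: le_trans xr; rewrite -addrA gerDl addrC subr_le0.
by rewrite ler_piMl.
Qed.

(** Relative interiority along the axis is enough to turn the derivative within
    [B] into an ordinary one. *)
Lemma has_pderiv_on_is_derive B (g : 'rV[R]_n -> R) i x t l :
  (\forall s \near t, B (subst_coord x i s)) ->
  has_pderiv_on B g i (subst_coord x i t) l ->
  is_derive t 1 (fun s => g (subst_coord x i s)) l.
Proof.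
move=> Bnear; rewrite /has_pderiv_on subst_coordE.
under eq_fun do rewrite subst_coord_twice.
move=> gl; apply/is_derive_quotientP => W /gl.
rewrite /= /dnbhs /within/= !nbhs_simpl/=.
move: Bnear; apply: filterS2 => s Bs; rewrite subst_coord_twice.
by move=> Ws st; apply: Ws.
Qed.

Lemma is_derive_has_pderiv_on B (g : 'rV[R]_n -> R) i x l :
  is_derive (x ord0 i) 1 (fun s => g (subst_coord x i s)) l ->
  has_pderiv_on B g i x l.
Proof.
move=> /is_derive_quotientP; rewrite subst_coord_id => gl.
exact: cvg_within_filter.
Qed.
End Coordinates.

(** * Integrals along coordinate segments *)

Section LineIntegrals.
Context {R : realType} {n m : nat} (dir : 'I_m -> 'I_n) (xb : 'rV[R]_n)
  (Phi : 'I_m -> 'rV[R]_n -> R).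
Implicit Types (B : set 'rV[R]_n) (G : 'I_m -> 'rV[R]_n -> R)
  (V : 'rV[R]_n -> 'rV[R]_m) (x : 'rV[R]_n) (j : 'I_m).

(** [V_j] is [Phi_j] plus the integral of [G_j] along the segment parallel to the
    axis [dir j] that starts on the hyperplane through [xb], expressed by
    derivatives.  Only the relative interior of each segment is constrained, so
    that a solution on a ball qualifies up to the boundary. *)
Definition integrates_on B G V := forall j x, B x ->
  [/\ V (subst_coord x (dir j) (xb ord0 (dir j))) ord0 j = Phi j x,
      {within `[0, 1], continuous (fun s => V (slide xb x (dir j) s) ord0 j)}
    & x ord0 (dir j) != xb ord0 (dir j) -> forall s : R, s \in `]0, 1[%R ->
      is_derive (xb ord0 (dir j) + s * (x ord0 (dir j) - xb ord0 (dir j))) 1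
        (fun t => V (subst_coord x (dir j) t) ord0 j)
        (G j (slide xb x (dir j) s))].

(** Existence is proved in this stronger form, which also gives the derivative at
    the ends of the segments. *)
Definition integrates G V := forall j x,
  V (subst_coord x (dir j) (xb ord0 (dir j))) ord0 j = Phi j x /\
  forall t : R, is_derive t 1 (fun s => V (subst_coord x (dir j) s) ord0 j)
    (G j (subst_coord x (dir j) t)).

Lemma integrates_onT B G V : integrates G V -> integrates_on B G V.
Proof.
move=> GV j x _; have [V0 dV] := GV j x; split => //.
apply: continuous_subspaceT.
exact: (continuous_affine (is_derive_continuous dV)).
Qed.

Lemma integrates_on_bound B G V M x j : integrates_on B G V -> B x ->
  (forall s, s \in `]0, 1[%R -> `|G j (slide xb x (dir j) s)| <= M) ->
  `|V x ord0 j - Phi j x| <= M * `|x ord0 (dir j) - xb ord0 (dir j)|.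
Proof.
move=> GV Bx GM; have [<- cV dV] := GV j x Bx.
by have := segment_increment_le_cst dV cV GM; rewrite subst_coord_id.
Qed.

(** Along the segment that ends at [x] the weight is
    [expR (lam * (rho + s * tau))], where [tau] is the length of the segment and
    [rho] the distance from [xb] to its starting point; its integral is at most
    [1 / lam] times its value at the end. The factor [m] counts the components
    that enter the 1-norm. *)
Lemma integrates_on_weighted B G1 G2 V1 V2 lam K : 0 < lam -> 0 <= K ->
  slide_stable xb B -> integrates_on B G1 V1 -> integrates_on B G2 V2 ->
  (forall j x, B x -> `|G1 j x - G2 j x| <= K * expR (lam * norm1 (x - xb))) ->
  forall x, B x ->
  norm1 (V1 x - V2 x) <= m%:R * (K / lam) * expR (lam * norm1 (x - xb)).
Proof.
move=> lam0 K0 stB GV1 GV2 G12 x Bx; rewrite -mulrA.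
apply: norm1_le_card => j; rewrite !mxE.
have [V10 cV1 dV1] := GV1 j x Bx; have [V20 cV2 dV2] := GV2 j x Bx.
set i := dir j in V10 cV1 dV1 V20 cV2 dV2 *.
pose tau := `|x ord0 i - xb ord0 i|; pose rho := norm1 (x - xb) - tau.
pose H (s : R) := K / lam * expR (lam * (rho + s * tau)).
have dH (s : R) : is_derive s 1 H (K * tau * expR (lam * (rho + s * tau))).
  have -> : H = cst (K / lam) * (expR \o (cst lam * (cst rho + id * cst tau))).
    by [].
  apply: is_derive_eq.
  rewrite -[(_ * _) s]/(lam * (rho + s * tau)).
  rewrite /cst !scaler0 !add0r !addr0 -![_ *: _]/(_ * _).
  by field; rewrite gt_eqF.
have := @segment_increment_le _
  (fun t => V1 (subst_coord x i t) ord0 j - V2 (subst_coord x i t) ord0 j)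
  (fun s => G1 j (slide xb x i s) - G2 j (slide xb x i s)) H _
  (xb ord0 i) (x ord0 i) _ _ dH.
rewrite V10 V20 subrr subr0 subst_coord_id => hyp.
apply: (le_trans (hyp _ _ _)).
- move=> xi s s01; have := dV1 xi s s01; have := dV2 xi s s01 => ? ?.
  exact: is_deriveB.
- by move=> s; exact: (cvgB (cV1 s) (cV2 s)).
- move=> s; rewrite in_itv/= => /andP[s0 s1].
  rewrite [K * tau]mulrC -mulrA ler_wpM2l//.
  have := G12 j (slide xb x i s); rewrite norm1_slide ?(ltW s0)//; apply.
  by apply: stB => //; rewrite !ltW.
rewrite /H mul1r subrK lerBlDr lerDl.
by rewrite mulr_ge0 ?expR_ge0// divr_ge0// ltW.
Qed.
End LineIntegrals.

(** Uniformity in [s] comes from the compactness of the segment. *)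
Lemma near_uniform_segment (R : realType) (T : topologicalType)
    (h : T -> R -> R) (x0 : T) (e : R) :
  continuous (fun p : T * R => h p.1 p.2) -> 0 < e ->
  \forall x \near x0, forall s : R, s \in `[0, 1]%R -> `|h x0 s - h x s| <= e.
Proof.
move=> ch e0.
have e20 : 0 < e / 2 by rewrite divr_gt0.
have /compact_near_coveringP/(_ T (nbhs x0)
  (fun x s => `|h x0 s - h x s| <= e) _) := @segment_compact R 0 1.
apply=> s _.
have /cvgrPdist_le/(_ _ e20)[[A B] /= [Ax Bs] AB] := ch (x0, s).
exists (B, A) => // -[s' x] /= [Bs' Ax'].
have h1 := AB (x0, s') (conj (nbhs_singleton Ax) Bs').
have h2 := AB (x, s') (conj Ax' Bs').
rewrite -(subrKA (h x0 s)) [e]splitr (le_trans (ler_normD _ _))//.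
by rewrite lerD// distrC.
Qed.

Section LineIntegralExistence.
Context {R : realType} {n m : nat} (dir : 'I_m -> 'I_n) (xb : 'rV[R]_n)
  (Phi : 'I_m -> 'rV[R]_n -> R).
Hypothesis Phi_continuous : forall j, continuous (Phi j).
Hypothesis Phi_subst : forall j x t, Phi j (subst_coord x (dir j) t) = Phi j x.

(** The primitives are chosen for lines and not for points: [I j x] is the
    primitive attached to the point [base j x] where the line through [x] meets
    the hyperplane, so that it is the same function for all [x] of a line.  Its
    value at [x_(dir j)] is continuous in [x] because the end point and the line
    of integration can be moved separately. *)
Lemma integrates_exists (G : 'I_m -> 'rV[R]_n -> R) M :
  (forall j, continuous (G j)) -> (forall j x, `|G j x| <= M) ->
  exists V, continuous V /\ integrates dir xb Phi G V.
Proof.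
move=> cG GM.
have cline j x : continuous (fun s => G j (subst_coord x (dir j) s)).
  move=> s; apply: (@cvg_comp _ _ _ (fun s => subst_coord x (dir j) s) (G j) _
    (nbhs (subst_coord x (dir j) s))).
    by apply: cvg_subst_coord; [exact: cvg_cst|exact: cvg_id].
  exact: cG.
have [P HP] := choice (fun a : 'I_m * 'rV[R]_n =>
  primitive_exists (xb ord0 (dir a.1)) (@cline a.1 a.2)).
pose base j (x : 'rV[R]_n) := subst_coord x (dir j) (xb ord0 (dir j)).
pose I j x := P (j, base j x).
have I_subst j x t : I j (subst_coord x (dir j) t) = I j x.
  by rewrite /I /base subst_coord_twice.
have I0 j x : I j x (xb ord0 (dir j)) = 0 by exact: (HP (j, base j x)).1.
have dI j x (t : R) : is_derive t 1 (I j x) (G j (subst_coord x (dir j) t)).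
  by have := (HP (j, base j x)).2 t; rewrite /= subst_coord_twice.
have cI j x : continuous (I j x).
  exact: (is_derive_continuous (dI j x)).
pose V x : 'rV[R]_m := \row_j (Phi j x + I j x (x ord0 (dir j))).
exists V; split; last first.
  move=> j x; split.
    by rewrite mxE Phi_subst I_subst subst_coordE I0 addr0.
  move=> t.
  have -> : (fun s => V (subst_coord x (dir j) s) ord0 j) = cst (Phi j x) + I j x.
    by apply/funext => s; rewrite mxE Phi_subst I_subst subst_coordE.
  have := dI j x t => ?.
  by rewrite -[X in is_derive _ _ _ X]add0r; exact: is_deriveD.
move=> x0; apply: (@cvg_row _ _ _ (nbhs x0)) => j; rewrite mxE.
under eq_cvg do rewrite mxE.
apply: cvgD; first exact: Phi_continuous.
set i := dir j; set c := xb ord0 i; set t0 := x0 ord0 i.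
have M0 : 0 <= M by exact: le_trans (GM j x0).
have end_point x t : `|I j x t - I j x t0| <= M * `|t - t0|.
  apply: (segment_increment_le_cst (fun _ s _ => dI j x _)) => [|s _ //].
  exact/continuous_subspaceT/continuous_affine.
have line e x : (forall s : R, s \in `[0, 1]%R ->
    `|G j (subst_coord x0 i (c + s * (t0 - c))) -
      G j (subst_coord x i (c + s * (t0 - c)))| <= e) ->
    `|I j x0 t0 - I j x t0| <= e * `|t0 - c|.
  move=> Ge.
  have dd (t : R) : is_derive t 1 (fun t => I j x0 t - I j x t)
      (G j (subst_coord x0 i t) - G j (subst_coord x i t)).
    by have := dI j x0 t; have := dI j x t => ? ?; exact: is_deriveB.
  have := segment_increment_le_cst (fun (_ : t0 != c) s _ => dd _).
  rewrite /= !I0 !subr0; apply.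
    exact: (continuous_subspaceT (continuous_affine (is_derive_continuous dd))).
  by move=> s s01; apply: Ge; apply: subset_itvW s01.
apply/cvgrPdist_le => e e0.
pose e1 := e / 2 / (M + 1); pose e2 := e / 2 / (`|t0 - c| + 1).
have e10 : 0 < e1 by rewrite !divr_gt0// ltr_wpDl.
have e20 : 0 < e2 by rewrite !divr_gt0// ltr_wpDl.
have near_end : \forall x \near x0, `|t0 - (x : 'rV[R]_n) ord0 i| <= e1.
  have : (fun x : 'rV[R]_n => x ord0 i) @ x0 --> t0 by exact: coord_continuous.
  by move/cvgrPdist_le; exact.
have near_line : \forall x \near x0, forall s : R, s \in `[0, 1]%R ->
    `|G j (subst_coord x0 i (c + s * (t0 - c))) -
      G j (subst_coord x i (c + s * (t0 - c)))| <= e2.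
  apply: (@near_uniform_segment _ _
    (fun x s => G j (subst_coord x i (c + s * (t0 - c))))) => // -[x s].
  apply: (@cvg_comp _ _ _ _ (G j) _
    (nbhs (subst_coord x i (c + s * (t0 - c))))); last exact: cG.
  apply: cvg_subst_coord; first exact: cvg_fst.
  exact: (cvgD (cvg_cst _) (cvgM cvg_snd (cvg_cst _))).
near=> x.
rewrite -(subrKA (I j x t0)) [e]splitr addrC (le_trans (ler_normD _ _))// lerD//.
  rewrite distrC (le_trans (end_point _ _))//.
  rewrite (@le_trans _ _ (M * e1))//.
    by rewrite ler_wpM2l// distrC; near: x.
  rewrite /e1 mulrCA ler_piMr ?divr_ge0 ?(ltW e0)// ler_pdivrMr ?ltr_wpDl//.
  by rewrite mul1r lerDl.
rewrite (@le_trans _ _ (e2 * `|t0 - c|))//.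
  by apply: line; near: x.
rewrite /e2 -mulrA ler_piMr ?divr_ge0 ?(ltW e0)// mulrC.
by rewrite ler_pdivrMr ?ltr_wpDl// mul1r lerDl.
Unshelve. all: by end_near. Qed.
End LineIntegralExistence.

(** * Successive approximations in a weighted norm *)

Lemma geometric_small (R : realType) (K e : R) : 0 < e ->
  exists k, K * 2^-1 ^+ k <= e.
Proof.
move=> e0; have half : `|2^-1 : R| < 1.
  by rewrite ger0_norm ?invr_ge0// invf_lt1 ?ltr1n.
have /cvgrPdist_le/(_ _ e0)[k _ /(_ k (leqnn k))] := cvg_geometric K half.
rewrite sub0r normrN /geometric/= => Ke.
by exists k; exact: le_trans (ler_norm _) Ke.
Qed.

(** The intervals of radius [2 C / 2^k] around [a k] are nested, so the infimum of
    their right ends lies in all of them. *)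
Lemma geometric_limit (R : realType) (a : nat -> R) C : 0 <= C ->
  (forall k, `|a k.+1 - a k| <= C * 2^-1 ^+ k) ->
  exists l, forall k, `|a k - l| <= 2 * C * 2^-1 ^+ k.
Proof.
move=> C0 aC.
pose A k := a k + 2 * C * 2^-1 ^+ k; pose B k := a k - 2 * C * 2^-1 ^+ k.
have half k : 2 * C * 2^-1 ^+ k.+1 = C * 2^-1 ^+ k by rewrite exprS; field.
have rad k : 0 <= C * 2^-1 ^+ k by rewrite mulr_ge0// exprn_ge0// invr_ge0.
have AS k : A k.+1 <= A k.
  by have := aC k; rewrite /A half ler_norml => /andP[_]; have := rad k; lra.
have BS k : B k <= B k.+1.
  by have := aC k; rewrite /B half ler_norml => /andP[+ _]; have := rad k; lra.
have BA j k : B j <= A k.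
  have mono (i l : nat) : (i <= l)%N -> A l <= A i /\ B i <= B l.
    move=> /subnK <-; elim: (l - i)%N => // d [IA IB].
    by rewrite addSn; split; [exact: le_trans (AS _) IA|exact: le_trans IB (BS _)].
  have [Aj Bj] := mono j (maxn j k) (leq_maxl _ _).
  have [Ak Bk] := mono k (maxn j k) (leq_maxr _ _).
  apply: le_trans Bj (le_trans _ Ak).
  by rewrite /A /B; have := rad (maxn j k); lra.
exists (inf (range A)) => k; rewrite ler_distlC; apply/andP; split.
  by apply: lb_le_inf; [exists (A 0); exists 0|move=> _ [i _ <-]; exact: BA].
by apply: ge_inf; [exists (B 0) => _ [i _ <-]; exact: BA|exists k].
Qed.

Section Picard.
Context {R : realType} {n m : nat} (dir : 'I_m -> 'I_n) (xb : 'rV[R]_n)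
  (Phi : 'I_m -> 'rV[R]_n -> R) (F : 'I_m -> 'rV[R]_n * 'rV[R]_m -> R) (M L : R).
Hypothesis F_bounded : forall j p, `|F j p| <= M.
Hypothesis F_lipschitz : forall j x u v,
  `|F j (x, u) - F j (x, v)| <= L * norm1 (u - v).
Hypothesis L_ge0 : 0 <= L.

Let along (V : 'rV[R]_n -> 'rV[R]_m) j x := F j (x, V x).

(* [lam] makes the contraction factor [m L / lam] at most one half. *)
Let lam := 2 * m%:R * L + 1.
Let w (x : 'rV[R]_n) := expR (lam * norm1 (x - xb)).

Let lam_gt0 : 0 < lam.
Proof. by rewrite ltr_wpDl// !mulr_ge0. Qed.

Let w_ge1 x : 1 <= w x.
Proof. by rewrite -expR0 ler_expR mulr_ge0 ?norm1_ge0// ltW. Qed.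

Lemma picard_contraction B V1 V2 W1 W2 K : 0 <= K -> slide_stable xb B ->
  integrates_on dir xb Phi B (along V1) W1 ->
  integrates_on dir xb Phi B (along V2) W2 ->
  (forall x, B x -> norm1 (V1 x - V2 x) <= K * w x) ->
  forall x, B x -> norm1 (W1 x - W2 x) <= K / 2 * w x.
Proof.
move=> K0 stB int1 int2 V12 x Bx.
have LK0 : 0 <= L * K by rewrite mulr_ge0.
apply: le_trans (integrates_on_weighted lam_gt0 LK0 stB int1 int2 _ Bx) _.
  move=> j y By; apply: le_trans (F_lipschitz _ _ _ _) _.
  by rewrite -mulrA ler_wpM2l// V12.
apply: ler_wpM2r; first exact: expR_ge0.
rewrite mulrA ler_pdivrMr// /lam.
rewrite -subr_ge0 (_ : _ - _ = K / 2); first by rewrite divr_ge0.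
by field.
Qed.

(** Whatever the two functions that are integrated, the results share their data
    and have bounded derivatives, so their distance is finite in the weighted
    norm: this starts the geometric estimates. *)
Lemma picard_initial B V1 V2 W1 W2 : slide_stable xb B ->
  integrates_on dir xb Phi B (along V1) W1 ->
  integrates_on dir xb Phi B (along V2) W2 ->
  forall x, B x ->
    norm1 (W1 x - W2 x) <= m%:R * (2 * `|M| / lam) * w x.
Proof.
move=> stB int1 int2 x Bx.
have M20 : 0 <= 2 * `|M| by rewrite mulr_ge0.
apply: (integrates_on_weighted lam_gt0 M20 stB int1 int2 _ Bx) => j y By.
apply: (@le_trans _ _ (2 * `|M|)); last by rewrite ler_peMr// w_ge1.
rewrite (le_trans (ler_normB _ _))// mulr_natl mulr2n.
by rewrite lerD// (le_trans (F_bounded _ _))// ler_norm.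
Qed.

Lemma picard_unique B V1 V2 : slide_stable xb B ->
  integrates_on dir xb Phi B (along V1) V1 ->
  integrates_on dir xb Phi B (along V2) V2 ->
  forall x, B x -> V1 x = V2 x.
Proof.
move=> stB int1 int2.
pose C := m%:R * (2 * `|M| / lam).
have C0 : 0 <= C by rewrite !mulr_ge0// invr_ge0 ltW.
have small k x : B x -> norm1 (V1 x - V2 x) <= C * 2^-1 ^+ k * w x.
  elim: k x => [|k IH] x Bx.
    by rewrite mulr1; exact: (picard_initial stB int1 int2 Bx).
  rewrite exprSr mulrA; apply: (picard_contraction _ stB int1 int2 IH Bx).
  by rewrite mulr_ge0// exprn_ge0// invr_ge0.
move=> x Bx; apply/subr0_eq/norm1_le0/ler_addgt0Pr => e e0; rewrite add0r.
have [k] := geometric_small (C * w x) e0.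
by apply: le_trans; rewrite mulrAC; exact: small.
Qed.

Hypothesis Phi_continuous : forall j, continuous (Phi j).
Hypothesis Phi_subst : forall j x t, Phi j (subst_coord x (dir j) t) = Phi j x.
Hypothesis F_continuous : forall j, continuous (F j).

Let along_continuous V : continuous V -> forall j, continuous (along V j).
Proof.
move=> cV j x; apply: (@cvg_comp _ _ _ (fun x => (x, V x)) (F j) _ (nbhs (x, V x))).
  exact: (cvg_pair cvg_id (cV x)).
exact: F_continuous.
Qed.

(** On a neighborhood of each point the weight is bounded, so that the limit is
    locally uniform and hence continuous; being continuous it can be integrated
    in turn, and the contraction estimate identifies the result with it. *)
Lemma picard_exists :
  exists U, continuous U /\ integrates dir xb Phi (along U) U.
Proof.
have step (V : 'rV[R]_n -> 'rV[R]_m) : exists W, continuous V ->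
    continuous W /\ integrates dir xb Phi (along V) W.
  have [cV|] := pselect (continuous V); last by exists V.
  have [W HW] := integrates_exists xb Phi_continuous Phi_subst
    (along_continuous cV) (fun j x => F_bounded j (x, V x)).
  by exists W.
have [T HT] := choice step.
have stT : slide_stable xb setT by [].
(* The approximations start at the image of 0 and not at 0, whose distance to its
   image, where the data enter, need not be finite in the weighted norm. *)
pose u k := iter k.+1 T (cst 0).
have uS k : continuous (u k) /\
    integrates dir xb Phi (along (iter k T (cst 0))) (u k).
  by elim: k => [|k [IH _]]; apply: HT => //; exact: cst_continuous.
have int_u k := integrates_onT (B := setT) (uS k).2.
pose C := m%:R * (2 * `|M| / lam).
have C0 : 0 <= C by rewrite !mulr_ge0// invr_ge0 ltW.
have geo0 k : 0 <= C * 2^-1 ^+ k by rewrite mulr_ge0// exprn_ge0// invr_ge0.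
have du k x : norm1 (u k.+1 x - u k x) <= C * 2^-1 ^+ k * w x.
  elim: k x => [|k IH] x.
    by rewrite mulr1; exact: (picard_initial stT (int_u 1) (int_u 0) I).
  rewrite exprSr mulrA.
  apply: (picard_contraction (geo0 k) stT (int_u k.+2) (int_u k.+1) _ I) => y _.
  exact: IH.
have w0 x : 0 <= w x by exact: expR_ge0.
have lim x j : exists l, forall k, `|u k x ord0 j - l| <= 2 * C * w x * 2^-1 ^+ k.
  have [k|l Hl] := @geometric_limit _ (fun k => u k x ord0 j) (C * w x)
    (mulr_ge0 C0 (w0 x)).
    rewrite mulrAC (le_trans _ (du k x))// (le_trans _ (coord_le_norm1 _ j))//.
    by rewrite !mxE.
  by exists l => k; rewrite -(mulrA 2).
have [U0 HU0] := choice (fun p : 'rV[R]_n * 'I_m => lim p.1 p.2).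
pose U x : 'rV[R]_m := \row_j U0 (x, j).
have uU k x : norm1 (u k x - U x) <= m%:R * (2 * C) * 2^-1 ^+ k * w x.
  rewrite -!(mulrA m%:R); apply: norm1_le_card => j; rewrite !mxE.
  by rewrite -(mulrA (2 * C)) [_ ^+ k * _]mulrC mulrA; exact: (HU0 (x, j)).
have cU : continuous U.
  move=> x0; apply: (@cvg_row _ _ _ (nbhs x0)) => j.
  apply/cvgrPdist_le => e e0.
  have e30 : 0 < e / 3 by rewrite divr_gt0.
  have [k Hk] := geometric_small (2 * C * (w x0 + 1)) e30.
  have cw : w x @[x --> x0] --> w x0.
    apply: (@cvg_comp _ _ _ (fun x => lam * norm1 (x - xb)) expR _
      (nbhs (lam * norm1 (x0 - xb)))).
      have cn : norm1 (x - xb) @[x --> x0] --> norm1 (x0 - xb).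
        exact: norm1_sub_continuous.
      exact: (@cvgM _ _ (nbhs x0) _ (cst lam) (fun x => norm1 (x - xb)) lam _
        (cvg_cst _) cn).
    exact: continuous_expR.
  have w_near : \forall x \near x0, w x <= w x0 + 1.
    have /cvgrPdist_le/(_ _ ltr01) := cw; apply: filterS => x.
    by rewrite ler_distlC => /andP[_].
  have cuj : (fun x => u k x ord0 j) @ x0 --> u k x0 ord0 j.
    apply: (@cvg_comp _ _ _ (u k) (fun v : 'rV[R]_m => v ord0 j) _ (nbhs (u k x0))).
      exact: (uS k).1.
    exact: coord_continuous.
  have /cvgrPdist_le/(_ _ e30) u_near := cuj.
  have close x : w x <= w x0 + 1 -> `|u k x ord0 j - U x ord0 j| <= e / 3.
    move=> wx; rewrite mxE; apply: le_trans (HU0 (x, j) k) (le_trans _ Hk).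
    by rewrite ler_wpM2r ?exprn_ge0 ?invr_ge0// ler_wpM2l// mulr_ge0.
  near=> x.
  have wx : w x <= w x0 + 1 by near: x.
  have ux : `|u k x0 ord0 j - u k x ord0 j| <= e / 3 by near: x.
  have w00 : w x0 <= w x0 + 1 by rewrite lerDl.
  move: (close x wx) (close x0 w00) ux.
  by rewrite !ler_norml => /andP[? ?] /andP[? ?] /andP[? ?]; apply/andP; split; lra.
exists U; split=> //.
have [_ int_TU] := HT U cU.
suff TU : T U = U by rewrite TU in int_TU.
apply/funext => x; apply/subr0_eq/norm1_le0/ler_addgt0Pr => e e0; rewrite add0r.
have D0 k : 0 <= m%:R * (2 * C) * 2^-1 ^+ k.
  by rewrite -mulrA mulr_ge0// -mulrA mulr_ge0// geo0.
have uTU k : norm1 (u k.+1 x - T U x) <= m%:R * (2 * C) * 2^-1 ^+ k / 2 * w x.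
  apply: (picard_contraction (D0 k) stT (int_u k.+1) (integrates_onT int_TU) _ I).
  by move=> y _; exact: uU.
have [k Hk] := geometric_small (2 * (m%:R * (2 * C)) * w x) e0.
apply: le_trans Hk.
have -> : T U x - U x = (u k.+1 x - U x) - (u k.+1 x - T U x).
  by rewrite opprB [RHS]addrC addrA subrK.
apply: le_trans (ler_norm1D _ _) _; rewrite norm1N.
apply: le_trans (lerD (uU k.+1 x) (uTU k)) _.
rewrite exprSr -subr_ge0.
set q := 2^-1 ^+ k.
have q0 : 0 <= q by rewrite exprn_ge0// invr_ge0.
rewrite [leRHS](_ : _ = m%:R * (2 * C) * q * w x); last by field.
by rewrite mulr_ge0// D0.
Unshelve. all: by end_near. Qed.
End Picard.

(** * Confinement of the values to a ball *)

Lemma continuous_comp_within (T S W : topologicalType) (A : set S)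
    (r : T -> S) (g : S -> W) :
  continuous r -> (forall x, A (r x)) -> {within A, continuous g} ->
  continuous (g \o r).
Proof.
move=> cr Ar /subspace_continuousP cg x; apply: cvg_comp (cg _ (Ar x)).
move=> X AX; have := cr x _ AX; rewrite nbhs_simpl/=.
by apply: filterS => y Xy; exact: Xy (Ar y).
Qed.

Lemma retract_continuous (R : realType) n (c : 'rV[R]_n) r :
  0 < r -> continuous (retract c r).
Proof.
move=> r0 x; apply: (@cvg_row _ _ _ (nbhs x)) => j.
apply/cvgrPdist_le => e e0.
have e20 : 0 < e / 2 by rewrite divr_gt0.
have /cvgrPdist_le/(_ _ e20) := @norm1_sub_continuous _ _ x x.
apply: filterS => y; rewrite subrr norm1_0 sub0r normrN ger0_norm ?norm1_ge0// => xy.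
have := coord_le_norm1 (retract c r x - retract c r y) j.
rewrite !mxE => /le_trans; apply; apply: le_trans (retract_lipschitz c x y r0) _.
by rewrite -norm1N opprB mulrC -ler_pdivlMr.
Qed.

Section InvariantBall.
Context {R : realType} {n m : nat} (dir : 'I_m -> 'I_n) (xb : 'rV[R]_n)
  (Phi : 'I_m -> 'rV[R]_n -> R) (G : 'I_m -> 'rV[R]_n -> R)
  (V : 'rV[R]_n -> 'rV[R]_m) (phib : 'rV[R]_m) (b M r : R).
Let B := cball1 xb r.
Hypothesis r_gt0 : 0 < r.
Hypothesis b_gt0 : 0 < b.
Hypothesis M_ge0 : 0 <= M.
Hypothesis r_small : M * m%:R * r <= b / 2.
Hypothesis Phi_near : forall j x, B x -> `|Phi j x - phib ord0 j| <= b / (2 * m%:R).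
Hypothesis G_bounded : forall j x, B x -> cball1 phib b (V x) -> `|G j x| <= M.
Hypothesis V_continuous : forall j, {within B, continuous (fun x => V x ord0 j)}.
Hypothesis V_integrates : integrates_on dir xb Phi B G V.

(* If the values are in the ball at all points closer to [xb] than [x], they are
   so on the interior of the segments that end at [x]: these segments have
   strictly increasing distance to [xb], unless they are reduced to [x], in which
   case [V x] is given by the data. *)
Let bound x : B x ->
  (forall y, B y -> norm1 (y - xb) < norm1 (x - xb) -> cball1 phib b (V y)) ->
  norm1 (V x - phib) <= b / 2 + M * m%:R * norm1 (x - xb).
Proof.
move=> Bx closer.
have coord j : `|(V x - phib) ord0 j| <= b / (2 * m%:R) + M * norm1 (x - xb).
  have -> : (V x - phib) ord0 j = (Phi j x - phib ord0 j) + (V x ord0 j - Phi j x).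
    by rewrite !mxE; ring.
  rewrite (le_trans (ler_normD _ _))// lerD ?Phi_near//.
  have [xi|xi] := eqVneq (x ord0 (dir j)) (xb ord0 (dir j)).
    have [<- _ _] := V_integrates j Bx.
    by rewrite -xi subst_coord_id subrr normr0 mulr_ge0 ?norm1_ge0.
  have xi0 : 0 < `|x ord0 (dir j) - xb ord0 (dir j)| by rewrite normr_gt0 subr_eq0.
  have le1 : `|x ord0 (dir j) - xb ord0 (dir j)| <= norm1 (x - xb).
    by have := coord_le_norm1 (x - xb) (dir j); rewrite !mxE.
  apply: (@le_trans _ _ (M * `|x ord0 (dir j) - xb ord0 (dir j)|));
    last exact: ler_wpM2l.
  apply: (integrates_on_bound V_integrates Bx) => s; rewrite in_itv/= => /andP[s0 s1].
  have By : B (slide xb x (dir j) s).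
    by apply: cball1_slide_stable => //; rewrite !ltW.
  apply: G_bounded => //; apply: closer => //.
  by rewrite norm1_slide ?(ltW s0)// -addrA gtrDl addrC subr_lt0 gtr_pMl.
apply: le_trans (norm1_le_card coord) _.
rewrite mulrDr [m%:R * (M * _)]mulrA [m%:R * M]mulrC lerD2r.
have [->|m0] := eqVneq (m%:R : R) 0; first by rewrite mul0r divr_ge0 ?ltW.
by rewrite invfM mulrCA (mulrCA m%:R) mulfV// mulr1.
Qed.

(** Among the points where the values have left the open ball of radius [b] take
    one, [z], that is nearest to [xb]. By [bound] and [r_small] it is at distance
    [r], so all points of [B] have the confinement hypothesis of [bound]. *)
Lemma integrates_on_invariant_ball x : B x -> cball1 phib b (V x).
Proof.
(* The retraction makes [g] continuous everywhere, so that the set [Z] below is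
   compact as a closed part of [B]. *)
pose g y := norm1 (V (retract xb r y) - phib).
have cg : continuous g.
  move=> y; apply: (@cvg_comp _ _ _ (fun y => V (retract xb r y))
    (fun v => norm1 (v - phib)) _ (nbhs (V (retract xb r y)))); last first.
    exact: norm1_sub_continuous.
  apply: (@cvg_row _ _ _ (nbhs y)) => j.
  exact: (@continuous_comp_within _ _ _ B (retract xb r) (fun z => V z ord0 j)
    (@retract_continuous _ _ xb r r_gt0) (fun z => retract_cball1 xb z r_gt0)
    (@V_continuous j) y).
pose Z := B `&` g @^-1` [set t | b <= t].
have cZ : compact Z.
  apply: compact_closedI; first exact: cball1_compact.
  by apply: closed_comp; [move=> z _; exact: cg|exact: closed_ge].
have notZ y : B y -> ~ Z y -> cball1 phib b (V y).
  move=> By nZ; rewrite /cball1/= leNgt; apply/negP => yb; apply: nZ; split=> //.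
  by rewrite /g/= retract_id// ltW.
have [Z0|/set0P Z0] := eqVneq Z set0; first by move=> Bx; apply: notZ; rewrite ?Z0.
have [z /set_mem[Bz zb] zmin] := @compact_EVT_min _ R
  (fun y : 'rV[R]_n => norm1 (y - xb)) Z Z0 cZ
  (continuous_subspaceT (@norm1_sub_continuous _ _ xb)).
have closer y : B y -> norm1 (y - xb) < norm1 (z - xb) -> cball1 phib b (V y).
  move=> By yz; apply: notZ => // Zy.
  by have := zmin y (mem_set Zy); rewrite leNgt yz.
have rz : r <= norm1 (z - xb).
  have Mm0 : 0 <= M * m%:R by rewrite mulr_ge0.
  move: zb; rewrite /g/= retract_id// => zb.
  have zb2 : b / 2 <= M * m%:R * norm1 (z - xb).
    by have := le_trans zb (bound Bz closer); rewrite {1}[b]splitr lerD2l.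
  have Mm : 0 < M * m%:R.
    rewrite lt_neqAle Mm0 andbT eq_sym; apply/eqP => Mm.
    by move: zb2; rewrite Mm mul0r leNgt divr_gt0.
  by rewrite -(ler_pM2l Mm) (le_trans r_small).
move=> Bx; rewrite /cball1/=; apply: le_trans (bound Bx _) _.
  by move=> y By yx; apply: closer => //; apply: lt_le_trans yx (le_trans Bx rz).
rewrite [leRHS]splitr lerD2l (le_trans _ r_small)//.
by rewrite ler_wpM2l// mulr_ge0.
Qed.
End InvariantBall.

(** * From partial derivatives to integrals along segments *)

Section PartialDerivatives.
Context {R : realType} {n m : nat} (dir : 'I_m -> 'I_n) (xb : 'rV[R]_n)
  (Phi : 'I_m -> 'rV[R]_n -> R) (B : set 'rV[R]_n).
Implicit Types (V : 'rV[R]_n -> 'rV[R]_m) (G : 'I_m -> 'rV[R]_n -> R).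
Hypothesis B_stable : slide_stable xb B.

Lemma eq_integrates_on G1 G2 V : (forall j x, B x -> G1 j x = G2 j x) ->
  integrates_on dir xb Phi B G1 V -> integrates_on dir xb Phi B G2 V.
Proof.
move=> G12 int1 j x Bx; have [V0 cV dV] := int1 j x Bx; split => // xi s s01.
rewrite -G12; first exact: dV.
by apply: B_stable => //; move: s01; rewrite in_itv/= => /andP[? ?]; rewrite !ltW.
Qed.

Lemma has_pderiv_integrates_on G V :
  (forall j, {within B, continuous (fun x => V x ord0 j)}) ->
  (forall j x, B x ->
     has_pderiv_on B (fun y => V y ord0 j) (dir j) x (G j x)) ->
  (forall j x, B x ->
     V (subst_coord x (dir j) (xb ord0 (dir j))) ord0 j = Phi j x) ->
  integrates_on dir xb Phi B G V.
Proof.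
move=> cV dV V0 j x Bx; split; first exact: V0.
  apply/subspace_continuousP => s s01.
  have Bs : B (slide xb x (dir j) s) by apply: B_stable.
  have /subspace_continuousP/(_ _ Bs) cVs := cV j.
  apply: cvg_comp cVs => W BW.
  have : (fun s => slide xb x (dir j) s) @ s --> slide xb x (dir j) s.
    apply: (@cvg_comp _ _ _ (fun s => (x, s))
      (fun p : 'rV[R]_n * R => slide xb p.1 (dir j) p.2) _ (nbhs (x, s))).
      exact: (cvg_pair (cvg_cst _) cvg_id).
    exact: (@slide_continuous _ _ xb (dir j) (x, s)).
  move=> /(_ _ BW); rewrite nbhs_simpl/= /within/=; apply: filterS => t Wt t01.
  by apply: Wt; apply: B_stable.
move=> xi s; rewrite in_itv/= => /andP[s0 s1].
set c := xb ord0 (dir j) in xi *; set y := x ord0 (dir j) in xi *.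
apply: (@has_pderiv_on_is_derive _ _ B (fun z : 'rV[R]_n => V z ord0 j)); last first.
  by apply: dV; apply: B_stable => //; rewrite !ltW.
have yc : y - c != 0 by rewrite subr_eq0.
have time : (t - c) / (y - c) @[t --> c + s * (y - c)] --> s.
  rewrite -[X in _ --> X](mulfK yc s) -[X in X / _](addrK c) [s * _ + c]addrC.
  exact: (cvgM (cvgB cvg_id (cvg_cst _)) (cvg_cst _)).
have /time : nbhs s `]0, 1[%classic.
  by apply: near_in_itvoo; rewrite in_itv/= s0 s1.
rewrite nbhs_simpl/=; apply: filterS => t /=; rewrite in_itv/= => /andP[t0 t1].
have := B_stable (dir j) Bx (s := (t - c) / (y - c)).
rewrite /slide -/c -/y divfK// (addrC c (t - c)) subrK; apply.
by rewrite !ltW.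
Qed.
End PartialDerivatives.

(** * The system in the variables indexed by pairs *)

Section System.
Context {R : realType} {n : nat} {N_ : 'I_n -> nat}.
Let N := (\sum_i N_ i)%N.
Let dir := @tagnat.sig1 n N_.
Let idx j : 'I_(N_ (dir j)) := @tagnat.sig2 n N_ j.

(** The unknowns are handled through their rank [j], with direction [dir j] and
    index [idx j]. Going back to pairs avoids casts between the types
    ['I_(N_ i)]. *)
Lemma tagnat_forall (P : forall i, 'I_(N_ i) -> Prop) :
  (forall j, P (dir j) (idx j)) -> forall i h, P i h.
Proof.
move=> H i h; have := H (tagnat.Rank i h).
by rewrite /dir /idx /tagnat.sig1 /tagnat.sig2 /tagnat.Rank tagnat.rankK.
Qed.

Lemma comp_idx (u : 'rV[R]_N) j : comp u (idx j) = u ord0 j.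
Proof. by rewrite /comp tagnat.sig2K. Qed.

Lemma col'_subst_coord (x : 'rV[R]_n) i t :
  col' i (subst_coord x i t) = col' i x.
Proof. by apply/rowP => k; rewrite !mxE eq_sym (negbTE (neq_lift _ _)). Qed.

Lemma cball1_col' (c x : 'rV[R]_n) i r :
  cball1 c r x -> cball1 (col' i c) r (col' i x).
Proof.
move=> xr; apply: le_trans xr; rewrite /norm1 [leRHS](bigD1_ord i)//=.
by rewrite ler_wpDl//; apply: ler_sum => k _; rewrite !mxE.
Qed.

Lemma col'_continuous i : continuous (fun x : 'rV[R]_n => col' i x).
Proof.
move=> x; apply: (@cvg_row _ _ _ (nbhs x)) => j; rewrite mxE.
under eq_cvg do rewrite mxE.
exact: coord_continuous.
Qed.

(** The suprema in [maxf] are attained, by compactness of the two balls; this is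
    what makes them upper bounds. *)
Lemma normr_le_maxf (xbar : 'rV[R]_n)
    (phi : forall i, 'I_(N_ i) -> 'rV[R]_n.-1 -> R)
    (f : forall i, 'I_(N_ i) -> 'rV[R]_n * 'rV[R]_N -> R) a b i (h : 'I_(N_ i)) p :
  {within Bab xbar phi a b, continuous (f i h)} -> Bab xbar phi a b p ->
  `|f i h p| <= maxf xbar phi f a b.
Proof.
move=> cf Bp.
have cB : compact (Bab xbar phi a b).
  by apply: compact_setX; exact: cball1_compact.
have cnf : {within Bab xbar phi a b, continuous (fun q => `|f i h q|)}.
  by move=> q; apply: cvg_norm; exact: cf.
have [q _ qmax] := compact_EVT_max (ex_intro _ p Bp) cB cnf.
apply: (@le_trans _ _ (sup [set `|f i h q| | q in Bab xbar phi a b])).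
  apply: ub_le_sup; last by exists p.
  by exists `|f i h q| => _ [q' Bq' <-]; apply: qmax; exact: mem_set.
apply: (le_trans (@le_bigmax _ R _ 0
  (fun h => sup [set `|f i h p| | p in Bab xbar phi a b]) h)).
exact: (@le_bigmax _ R _ 0 (fun i => \big[Num.max/0]_(h < N_ i)
  sup [set `|f i h p| | p in Bab xbar phi a b]) i).
Qed.

Section Sigma.
Variables (xbar : 'rV[R]_n) (phi : forall i, 'I_(N_ i) -> 'rV[R]_n.-1 -> R)
    (f : forall i, 'I_(N_ i) -> 'rV[R]_n * 'rV[R]_N -> R) (a b : R).
Hypotheses (a_gt0 : 0 < a) (b_gt0 : 0 < b).

Lemma maxf_ge0 : 0 <= maxf xbar phi f a b.
Proof. exact: bigmax_ge_id. Qed.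

Lemma sigma_le : sigma xbar phi f a b <= a.
Proof. by rewrite /sigma; case: eqP => // _; rewrite ge_min lexx. Qed.

Let MN_gt0 : maxf xbar phi f a b * N%:R != 0 -> 0 < maxf xbar phi f a b * N%:R.
Proof. by move=> MN; rewrite lt_neqAle eq_sym MN mulr_ge0// maxf_ge0. Qed.

Lemma sigma_gt0 : 0 < sigma xbar phi f a b.
Proof.
rewrite /sigma; case: eqVneq => // /MN_gt0 MN.
by rewrite lt_min a_gt0 divr_gt0// mulr_gt0.
Qed.

Lemma sigma_small :
  maxf xbar phi f a b * N%:R * sigma xbar phi f a b <= b / 2.
Proof.
rewrite /sigma; case: eqVneq => [->|/MN_gt0 MN].
  by rewrite mul0r divr_ge0// ltW.
rewrite -ler_pdivlMl// ge_min; apply/orP; right.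
by rewrite invfM mulrA mulrC.
Qed.
End Sigma.
End System.

Theorem theorem2p3 (R : realType) (n : nat) (N_ : 'I_n -> nat)
    (xbar : 'rV[R]_n)
    (phi : forall i : 'I_n, 'I_(N_ i) -> 'rV[R]_n.-1 -> R)
    (Df : forall i : 'I_n, 'I_(N_ i) -> set ('rV[R]_n * 'rV[R]_(\sum_i N_ i)))
    (f : forall i : 'I_n, 'I_(N_ i) -> 'rV[R]_n * 'rV[R]_(\sum_i N_ i) -> R)
    (HDf : forall (i : 'I_n) (h : 'I_(N_ i)),
      nbhs (xbar, phibar xbar phi) (Df i h))
    (a b L : R) (Ha : 0 < a) (Hb : 0 < b) (HL : 0 < L)
    (A1 : forall (i : 'I_n) (h : 'I_(N_ i)),
      [/\ Bab xbar phi a b `<=` Df i h,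
          {within Bab xbar phi a b, continuous (f i h)}
        & forall x u v, Bab xbar phi a b (x, u) -> Bab xbar phi a b (x, v) ->
            `|f i h (x, u) - f i h (x, v)| <= L * norm1 (u - v)])
    (A2 : forall (i : 'I_n) (h : 'I_(N_ i)),
      {within cball1 (col' i xbar) a, continuous (phi i h)} /\
      forall y, cball1 (col' i xbar) a y ->
        `|phi i h y - comp (phibar xbar phi) h|
          <= b / (2 * (\sum_i N_ i)%:R)) :
  let B := cball1 xbar (sigma xbar phi f a b) in
  exists u : 'rV[R]_n -> 'rV[R]_(\sum_i N_ i),
    is_solution xbar phi f Df B u /\
    forall v : 'rV[R]_n -> 'rV[R]_(\sum_i N_ i),
      is_solution xbar phi f Df B v -> forall x, B x -> v x = u x.
Proof.
move=> B; set N := (\sum_i N_ i)%N in f Df HDf A1 A2 B *.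
pose M := maxf xbar phi f a b; pose sig := sigma xbar phi f a b.
pose phib := phibar xbar phi.
pose dir (j : 'I_N) : 'I_n := @tagnat.sig1 n N_ j.
pose idx (j : 'I_N) : 'I_(N_ (dir j)) := @tagnat.sig2 n N_ j.
have sig_a : cball1 xbar sig `<=` cball1 xbar a.
  by move=> x /le_trans; apply; exact: sigma_le.
have sig0 : 0 < sig by exact: sigma_gt0.
have stB : slide_stable xbar B by exact: cball1_slide_stable.
pose F j (p : 'rV[R]_n * 'rV[R]_N) :=
  f (dir j) (idx j) (retract xbar a p.1, retract phib b p.2).
pose Phi j (x : 'rV[R]_n) :=
  phi (dir j) (idx j) (retract (col' (dir j) xbar) a (col' (dir j) x)).
have in_Bab p : Bab xbar phi a b (retract xbar a p.1, retract phib b p.2).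
  by split; exact: retract_cball1.
have f_bounded j p : Bab xbar phi a b p -> `|f (dir j) (idx j) p| <= M.
  by have [_ cf _] := A1 (dir j) (idx j); exact: normr_le_maxf.
have F_bounded j p : `|F j p| <= M by exact/f_bounded/in_Bab.
have F_lipschitz j x u v : `|F j (x, u) - F j (x, v)| <= L * 2 * norm1 (u - v).
  have [_ _ lip] := A1 (dir j) (idx j).
  rewrite (le_trans (lip _ _ _ (in_Bab (x, u)) (in_Bab (x, v))))// -mulrA.
  by rewrite ler_pM2l// retract_lipschitz.
have F_continuous j : continuous (F j).
  have [_ cf _] := A1 (dir j) (idx j).
  apply: (@continuous_comp_within _ _ _ (Bab xbar phi a b)
    (fun p => (retract xbar a p.1, retract phib b p.2)) (f (dir j) (idx j))) => //.
  move=> p.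
  have c1 : (fun q : 'rV[R]_n * 'rV[R]_N => retract xbar a q.1) @ p -->
      retract xbar a p.1.
    by apply: cvg_comp; [exact: cvg_fst|exact: retract_continuous].
  have c2 : (fun q : 'rV[R]_n * 'rV[R]_N => retract phib b q.2) @ p -->
      retract phib b p.2.
    by apply: cvg_comp; [exact: cvg_snd|exact: retract_continuous].
  exact: (cvg_pair c1 c2).
have Phi_continuous j : continuous (Phi j).
  have [cphi _] := A2 (dir j) (idx j).
  apply: (@continuous_comp_within _ _ _ (cball1 (col' (dir j) xbar) a)
    (fun x => retract (col' (dir j) xbar) a (col' (dir j) x))
    (phi (dir j) (idx j))) => //.
    move=> x; apply: (@cvg_comp _ _ _ (fun x => col' (dir j) x) _ _
      (nbhs (col' (dir j) x))).
      exact: col'_continuous.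
    exact: retract_continuous.
  by move=> x; exact: retract_cball1.
have Phi_subst j x t : Phi j (subst_coord x (dir j) t) = Phi j x.
  by rewrite /Phi col'_subst_coord.
have PhiE j x : B x -> Phi j x = phi (dir j) (idx j) (col' (dir j) x).
  by move=> Bx; rewrite /Phi retract_id//; apply/cball1_col'/sig_a.
have FE j x u : B x -> cball1 phib b u -> F j (x, u) = f (dir j) (idx j) (x, u).
  by move=> Bx bu; rewrite /F/= !retract_id//; exact: sig_a.
have Phi_near j x : B x -> `|Phi j x - phib ord0 j| <= b / (2 * N%:R).
  move=> Bx; have [_ /(_ (col' (dir j) x))] := A2 (dir j) (idx j).
  by rewrite PhiE// comp_idx; apply; apply/cball1_col'/sig_a.
(* Used for [U], which solves the retracted system, and for any solution [v] of
   the given one. *)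
have in_ball G V := @integrates_on_invariant_ball _ _ _ dir xbar Phi G V phib b M
  sig sig0 Hb (maxf_ge0 _ _ _ _ _) (sigma_small _ _ _ _ Hb) Phi_near.
have [U [cU int_U]] := picard_exists xbar F_bounded F_lipschitz
  (mulr_ge0 (ltW HL) (ler0n _ 2)) Phi_continuous Phi_subst F_continuous.
have cUj j : continuous (fun x => U x ord0 j).
  move=> x; apply: (@cvg_comp _ _ _ U (fun v : 'rV[R]_N => v ord0 j) _ (nbhs (U x))).
    exact: cU.
  exact: coord_continuous.
have U_ball x : B x -> cball1 phib b (U x).
  apply: (in_ball _ _ _ _ (integrates_onT int_U)) => // j.
  exact: continuous_subspaceT.
exists U; split.
  have U_pderiv j x : B x -> has_pderiv_on B (fun y => comp (U y) (idx j)) (dir j) x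
      (f (dir j) (idx j) (x, U x)).
    move=> Bx; apply: is_derive_has_pderiv_on.
    have [_ /(_ (x ord0 (dir j)))] := int_U j x.
    rewrite subst_coord_id FE//; last exact: U_ball.
    by under eq_fun do rewrite -comp_idx.
  apply: tagnat_forall => j; split.
  - split.
      apply: continuous_subspaceT.
      by under eq_fun do rewrite comp_idx; exact: cUj.
    exists (fun x => f (dir j) (idx j) (x, U x)); split; last exact: U_pderiv.
    apply: (subspace_eq_continuous (f := fun x => F j (x, U x))).
      by move=> x /set_mem Bx; rewrite /from_subspace FE//; exact: U_ball.
    apply: continuous_subspaceT => x.
    apply: (@cvg_comp _ _ _ (fun x => (x, U x)) (F j) _ (nbhs (x, U x))).
      exact: (cvg_pair cvg_id (cU x)).
    exact: F_continuous.
  - move=> x Bx; have [sub _ _] := A1 (dir j) (idx j); apply: sub.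
    by split; [exact: sig_a|exact: U_ball].
  - exact: U_pderiv.
  - by move=> x Bx; have [+ _] := int_U j x; rewrite comp_idx -PhiE.
move=> v v_sol x Bx.
have cv j : {within B, continuous (fun x => v x ord0 j)}.
  have [[+ _] _ _ _] := v_sol (dir j) (idx j).
  by under eq_fun do rewrite comp_idx.
have int_v : integrates_on dir xbar Phi B (fun j y => f (dir j) (idx j) (y, v y)) v.
  apply: has_pderiv_integrates_on => // j y By.
    have [_ _ /(_ y By) + _] := v_sol (dir j) (idx j).
    by under eq_fun do rewrite comp_idx.
  by have [_ _ _ /(_ y By)] := v_sol (dir j) (idx j); rewrite comp_idx PhiE.
have v_ball y : B y -> cball1 phib b (v y).
  apply: (in_ball _ _ _ _ int_v) => // j z Bz bz; apply: f_bounded.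
  by split=> //; exact: sig_a.
apply: (picard_unique F_bounded F_lipschitz _ stB) Bx.
- by rewrite mulr_ge0// ltW.
- apply: eq_integrates_on int_v => // j y By.
  by rewrite FE//; exact: v_ball.
- exact: integrates_onT int_U.
Qed.
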